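(* Let $V,\tau,\rho,\mu,r,h,K,d$ and the cost functional $C(R)$ be as in the context. Consider the problem of minimizing $C(R)$ over all random variables $R$ on $(\Omega,\mathcal F,P)$ with $\rho<R\le r$ $P$-a.s. and $E\frac{V}{R-\rho}<\infty$. Then there exists an optimal $R$ which is a nondecreasing deterministic function of $V$. More precisely, there is $\lambda\ge0$ such that, with $$\varphi(v)=\rho+\left[\frac{1}{r-\rho}+\frac{\left(\lambda-\frac v2\right)^+}{2\mu\rho}\right]^{-1},\qquad v\geq 0,$$ which is nondecreasing in $v$, the random variable $R=\varphi(V)$ is a minimizer.
   Context: Notation: $a^+=\max\{a,0\}$. On a probability space $(\Omega,\mathcal F,P)$ with a filtration $\mathbb F$ satisfying the usual conditions, $J=(J_t)_{t\ge0}$ is a subordinator with respect to $\mathbb F$ (adapted, nondecreasing, right-continuous, $J_0=0$, stationary increments, $J_{t+s}-J_t$ independent of $\mathcal F_t$) with Lévy measure $\nu$ and finite mean $\rho=EJ_1$; $\tau$ is an $\mathbb F$-stopping time with $E\tau<\infty$ and $V:=J_\tau>0$ a.s., and $EV^2<\infty$. Let $\mu=\frac{1}{2\rho}\int_{(0,\infty)}x^2\nu(dx)$, with $0<\mu<\infty$. The constants $h,K,d\in(0,\infty)$ are a holding cost rate, a setup cost and an output capacity cost rate, and $\rho<r<\infty$ is a maximal output rate. $V$ is the workload at the beginning of an on period, $R$ is the output rate used during that on period (until the workload hits $0$), and $\tilde Z^\tau$ denotes the steady-state distribution of the workload restricted to off periods, so that $E\tau\,E\tilde Z^\tau=E\int_0^\tau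 J_t\,dt$. The steady-state expected cost is $$C(R)=\frac{hE\tau E\tilde Z^\tau+K+dEV+d\rho E\frac{V}{R-\rho}+hE\left[\frac{V^2}{2(R-\rho)}+\mu\rho\frac{V}{(R-\rho)^2}\right]}{E\tau+E\frac{V}{R-\rho}}\in(0,\infty].$$ *)

(* Defs.v *)
From mathcomp Require Import all_boot all_order all_algebra.
From mathcomp Require Import all_classical all_reals all_analysis.

Set Implicit Arguments.
Unset Strict Implicit.
Unset Printing Implicit Defensive.

Import Order.TTheory GRing.Theory Num.Theory.
Import numFieldNormedType.Exports.

Local Open Scope classical_set_scope.
Local Open Scope ring_scope.

(** Time is the half-line [0, +oo[: families indexed by [R] are only
    constrained, and only used, at nonnegative indices. *)

Definition filtration {disp : measure_display} {T : measurableType disp}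
    {R : realType} (F : R -> set (set T)) : Prop :=
  [/\ forall t : R, 0 <= t -> sigma_algebra setT (F t),
      forall t : R, 0 <= t -> F t `<=` measurable &
      forall s t : R, 0 <= s -> s <= t -> F s `<=` F t].

Definition usual_conditions {disp : measure_display} {T : measurableType disp}
    {R : realType} (P : probability T R) (F : R -> set (set T)) : Prop :=
  [/\ measure_is_complete P,
      forall N : set T, P.-negligible N -> F 0 N &
      forall t : R, 0 <= t -> \bigcap_(s in `]t, +oo[) F s `<=` F t].

Definition adapted {disp : measure_display} {T : measurableType disp}
    {R : realType} (F : R -> set (set T)) (J : R -> T -> R) : Prop :=
  forall t : R, 0 <= t -> forall B : set R, measurable B -> F t (J t @^-1` B).

(** Stopping times may take the value [+oo]. *)
Definition stopping_time {disp : measure_display} {T : measurableType disp}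
    {R : realType} (F : R -> set (set T)) (tau : T -> \bar R) : Prop :=
  (forall w, (0 <= tau w)%E) /\
  (forall t : R, 0 <= t -> F t [set w | (tau w <= t%:E)%E]).

(** The random variable [X] is independent of the class of events [G]. *)
Definition independent_of {disp : measure_display} {T : measurableType disp}
    {R : realType} (P : probability T R) (X : T -> R) (G : set (set T)) : Prop :=
  forall (A : set T) (B : set R), G A -> measurable B ->
    P (A `&` X @^-1` B) = (P A * P (X @^-1` B))%E.

(** The path properties are only required almost surely. *)
Definition subordinator {disp : measure_display} {T : measurableType disp}
    {R : realType} (P : probability T R) (F : R -> set (set T))
    (J : R -> T -> R) : Prop :=
  [/\ adapted F J,
      {ae P, forall w,
        [/\ J 0 w = 0,
            forall s t : R, 0 <= s -> s <= t -> J s w <= J t w &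
            forall t : R, 0 <= t -> J s w @[s --> t^'+] --> J t w]},
      forall s t u : R, 0 <= s -> 0 <= t -> 0 <= u ->
        forall B : set R, measurable B ->
          P ((fun w => J (t + s) w - J t w) @^-1` B) =
          P ((fun w => J (u + s) w - J u w) @^-1` B) &
      forall s t : R, 0 <= s -> 0 <= t ->
        independent_of P (fun w => J (t + s) w - J t w) (F t)].

(** [nu] is the Lévy measure of [J], as given by the Lévy-Khintchine formula
    for subordinators (with a possible drift [c]):
    E exp(- s J_t) = exp(- t (c s + \int_(0,oo) (1 - exp(- s x)) nu(dx))). *)
Definition levy_measure_of {disp : measure_display} {T : measurableType disp}
    {R : realType} (P : probability T R) (J : R -> T -> R)
    (nu : {measure set (measurableTypeR R) -> \bar R}) : Prop :=
  [/\ nu [set x : R | x <= 0] = 0%E,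
      (\int[nu]_(x in `]0%R, +oo[) (Num.min x 1%R)%:E < +oo)%E &
      exists2 c : R, 0 <= c &
        forall s t : R, 0 <= s -> 0 <= t ->
          'E_P[fun w => expR (- s * J t w)]%E =
          (expR (- t * (c * s +
             \int[nu]_(x in `]0, +oo[) (1 - expR (- s * x)))))%:E].

(** The random variable J_tau; its value where [tau] is infinite is
    irrelevant when [tau] has finite mean. *)
Definition stopped {T : Type} {R : realType} (J : R -> T -> R)
    (tau : T -> \bar R) : T -> R :=
  fun w => J (fine (tau w)) w.

(** Mean of the steady-state workload during off periods, determined by
    E tau * (this mean) = E \int_0^tau J_t dt. *)
Definition mean_off_workload {disp : measure_display}
    {T : measurableType disp} {R : realType} (P : probability T R)
    (J : R -> T -> R) (tau : T -> \bar R) : \bar R :=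
  ((\int[P]_w \int[lebesgue_measure]_(t in [set t : R | (0 <= t)%R /\ t%:E <= tau w])
      (J t w)%:E) / \int[P]_w tau w)%E.

(** The cost C(X) of using the (random) output rate [X]. *)
Definition cost {disp : measure_display} {T : measurableType disp}
    {R : realType} (P : probability T R) (J : R -> T -> R) (tau : T -> \bar R)
    (rho mu h K d : R) (X : T -> R) : \bar R :=
  let V := stopped J tau in
  ((h%:E * \int[P]_w tau w * mean_off_workload P J tau + K%:E + d%:E * 'E_P[V]
     + d%:E * rho%:E * 'E_P[fun w => (V w / (X w - rho))%R]
     + h%:E * 'E_P[fun w => (V w ^+ 2 / (2 * (X w - rho))
                             + mu * rho * (V w / (X w - rho) ^+ 2))%R])
   / (\int[P]_w tau w + 'E_P[fun w => (V w / (X w - rho))%R]))%E.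

Definition admissible {disp : measure_display} {T : measurableType disp}
    {R : realType} (P : probability T R) (V : T -> R) (rho r : R)
    (X : T -> R) : Prop :=
  [/\ measurable_fun setT X,
      {ae P, forall w, rho < X w /\ X w <= r} &
      ('E_P[fun w => (V w / (X w - rho))%R] < +oo)%E].

Definition phi {R : realType} (rho mu r lambda : R) (v : R) : R :=
  rho + ((r - rho)^-1 + Num.max (lambda - v / 2) 0 / (2 * mu * rho))^-1.

(* Main.v *)
(** In terms of [Y = 1 / (R - rho) >= a = 1 / (r - rho)] the cost is a ratio
    [N Y / D Y] with [D] affine and [N] convex quadratic in [Y], both
    expectations of functions of the pair [(V, Y)].  For a price [c], the
    difference [N Y - c * D Y] is minimized pointwise in [V]: completing the
    square gives [Y = a + max (lambda - V / 2) 0 / (2 * mu * rho)] with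
    [c = d * rho + h * (lambda + 2 * a * mu * rho)].  At the price where the
    minimal difference vanishes, the minimizer of the difference minimizes the
    ratio (Dinkelbach's argument).  A nonpositive [lambda] gives the same rate
    as [lambda = 0], because [V > 0]. *)

Require Import Defs.
From mathcomp Require Import all_boot all_order all_algebra.
From mathcomp Require Import all_classical all_reals all_analysis.
From mathcomp Require Import measurable_realfun ring lra.

Set Implicit Arguments.
Unset Strict Implicit.
Unset Printing Implicit Defensive.

Import Order.TTheory GRing.Theory Num.Theory.
Import numFieldNormedType.Exports.

Local Open Scope classical_set_scope.
Local Open Scope ring_scope.

(** * Measurability of the stopped process *)

(** Multiplying by the indicator of the complement of a null set turns almost sure convergence into
    convergence everywhere; completeness then carries measurability from [g] to [f]. *)
Lemma ae_cvg_measurable_fun {d : measure_display} {T : measurableType d}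
    {R : realType} (mu : {measure set T -> \bar R}) (f_ : nat -> T -> R)
    (f : T -> R) :
  measure_is_complete mu -> (forall n, measurable_fun setT (f_ n)) ->
  {ae mu, forall w, f_ n w @[n --> \oo] --> f w} -> measurable_fun setT f.
Proof.
move=> cmu mf_ [N [mN N0 fN]].
pose g w := f w * \1_(~` N) w.
have mg : measurable_fun setT g.
  apply: (@measurable_fun_cvg _ _ _ _ (fun n w => f_ n w * \1_(~` N) w)) => [n|w _].
    apply: measurable_funM; first exact: mf_.
    by apply: measurable_indic; exact: measurableC.
  rewrite /g indicE; case: (boolP (w \in ~` N)) => [|_].
    rewrite inE => Nw; apply: cvgMl; apply: contrapT => nf.
    by apply: Nw; exact: fN.
  rewrite mulr0; under eq_fun do rewrite mulr0; exact: cvg_cst.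
apply/measurable_EFinP.
apply: (@ae_measurable_fun _ _ _ _ cmu setT (EFin \o g)) => /=; last exact/measurable_EFinP.
exists N; split => // w /= fgw; apply: contrapT => Nw; apply: fgw => _.
by rewrite /g indicE mem_set ?mulr1.
Qed.

Lemma stopping_time_measurable_fun {d : measure_display}
    {T : measurableType d} {R : realType} (F : R -> set (set T))
    (tau : T -> \bar R) :
  filtration F -> stopping_time F tau -> measurable_fun setT tau.
Proof.
move=> [_ Fm _] [tau0 Ft].
apply: (measurability _ (ErealGenOInfty.measurableE R)) => _ [_ [t ->] <-].
rewrite setTI.
have [t0|t0] := leP 0 t.
  rewrite -[X in measurable X]setCK; apply: measurableC.
  rewrite (_ : ~` _ = [set w | (tau w <= t%:E)%E]); first exact/Fm/Ft.
  apply/seteqP; split => w /=; rewrite in_itv /= andbT.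
    by move=> /negP; rewrite -leNgt.
  by move=> ?; apply/negP; rewrite -leNgt.
(* The filtration says nothing at negative [t], but [tau] is nonnegative. *)
rewrite (_ : _ @^-1` _ = setT) //; apply/seteqP; split => w //= _.
by rewrite in_itv /= andbT (lt_le_trans _ (tau0 w)) // lte_fin.
Qed.

Lemma measurable_fun_natidx {d : measure_display} {T : measurableType d}
    {R : realType} (G : nat -> T -> R) (k : T -> nat) :
  (forall i, measurable_fun setT (G i)) ->
  (forall i, measurable [set w | k w = i]) ->
  measurable_fun setT (fun w => G (k w) w).
Proof.
move=> mG mk _ B mB; rewrite setTI.
rewrite (_ : _ @^-1` _ = \bigcup_i ([set w | k w = i] `&` G i @^-1` B)).
  apply: bigcupT_measurable => i; apply: measurableI => //.
  by rewrite -[X in measurable X]setTI; exact: mG.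
apply/seteqP; split => w /=; first by exists (k w).
by move=> [i _ /= [<-]].
Qed.

(* The time [tau] is approached strictly from above by the grid times
   [(k + 1) / (n + 1)] with [k] the integer part of [(n + 1) * tau]. *)
Lemma stopped_measurable_fun {d : measure_display} {T : measurableType d}
    {R : realType} (P : probability T R) (F : R -> set (set T))
    (J : R -> T -> R) (tau : T -> \bar R) :
  filtration F -> measure_is_complete P -> adapted F J ->
  {ae P, forall w t, 0 <= t -> J s w @[s --> t^'+] --> J t w} ->
  stopping_time F tau -> measurable_fun setT (stopped J tau).
Proof.
move=> fF cP aJ rc st.
have [_ Fm _] := fF.
have mtau : measurable_fun setT (fine \o tau).
  apply: measurableT_comp => //; exact: stopping_time_measurable_fun st.
have mJ t : 0 <= t -> measurable_fun setT (J t).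
  by move=> t0 _ B mB; rewrite setTI; exact/(Fm t)/aJ.
(* [fine] maps [+oo] to 0, so the grid argument applies also where [tau] is infinite. *)
have tau0 w : 0 <= fine (tau w) by apply: fine_ge0; case: st.
pose k n w := Num.truncn (n.+1%:R * fine (tau w)).
pose s n w : R := (k n w).+1%:R / n.+1%:R.
have s_itv n w : fine (tau w) < s n w <= fine (tau w) + n.+1%:R^-1.
  have /andP[k1 k2] : (k n w)%:R <= n.+1%:R * fine (tau w) < (k n w).+1%:R.
    by apply: truncn_itv; rewrite mulr_ge0.
  rewrite /s ltr_pdivlMr ?ltr0n // mulrC k2 /= ler_pdivrMr ?ltr0n // mulrDl mulVf ?pnatr_eq0 //.
  by rewrite -natr1 lerD2r mulrC.
apply: (@ae_cvg_measurable_fun _ _ _ _ (fun n w => J (s n w) w)) cP _ _ => [n|].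
  apply: (@measurable_fun_natidx _ _ _ (fun i => J (i.+1%:R / n.+1%:R)) (k n)) => i.
    by apply: mJ; rewrite divr_ge0.
  rewrite (_ : [set w | _] = setT `&` (fine \o tau) @^-1` `[i%:R / n.+1%:R, i.+1%:R / n.+1%:R[).
    by apply: mtau => //; exact: measurable_itv.
  rewrite setTI; apply/seteqP; split => w /=; rewrite in_itv /= ler_pdivrMr ?ltr0n // ltr_pdivlMr ?ltr0n // mulrC.
    by move=> <-; apply: truncn_itv; rewrite mulr_ge0.
  by move=> H; apply: truncn_def.
apply: filterS rc => w /(_ _ (tau0 w)) /cvg_at_rightP; apply; split => [n|].
  by have /andP[] := s_itv n w.
apply: (@squeeze_cvgr _ _ _ _ (fun=> fine (tau w)) (fun n => fine (tau w) + n.+1%:R^-1)).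
- by near=> n; have /andP[/ltW -> ->] := s_itv n w.
- exact: cvg_cst.
- rewrite -[X in _ --> X]addr0; apply: cvgD; first exact: cvg_cst.
  exact: cvg_harmonic.
Unshelve. all: by end_near. Qed.

(** * Reciprocals, and integrals under almost sure hypotheses *)

(** Inversion, with value 0 at 0, is continuous only off the origin, hence the splitting of the
    line. *)
Lemma measurable_inv {R : realType} : measurable_fun [set: R] (@GRing.inv R).
Proof.
rewrite -(setUv [set 0]); apply/measurable_funU => //; first exact: measurableC.
split; first exact: measurable_fun_set1.
apply: open_continuous_measurable_fun => [|x].
  by apply: closed_openC; exact: closed_eq.
by rewrite inE /= => /eqP x0; exact: inv_continuous.
Qed.

Lemma measurable_funV {d : measure_display} {T : measurableType d}
    {R : realType} (f : T -> R) :
  measurable_fun setT f -> measurable_fun setT (fun w => (f w)^-1).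
Proof. by apply: measurableT_comp; exact: measurable_inv. Qed.

Section ae_integral.
Context {d : measure_display} {T : measurableType d} {R : realType}.
Variable mu : {measure set T -> \bar R}.
Implicit Types f g : T -> R.

(** The absolute value turns almost sure nonnegativity into nonnegativity everywhere and keeps the
    integral. *)
Lemma ae_ge0_integral_norm f : measurable_fun setT f ->
  {ae mu, forall w, 0 <= f w} ->
  (\int[mu]_w `|f w|%:E = \int[mu]_w (f w)%:E)%E.
Proof.
move=> mf f0; apply: ae_eq_integral => //.
- by apply/measurable_EFinP; exact: measurableT_comp.
- exact/measurable_EFinP.
- by apply: filterS f0 => w f0 _; rewrite ger0_norm.
Qed.

Lemma ae_ge0_integrable f : measurable_fun setT f ->
  {ae mu, forall w, 0 <= f w} -> (\int[mu]_w (f w)%:E < +oo)%E ->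
  mu.-integrable setT (EFin \o f).
Proof.
move=> mf f0 foo; apply/integrableP; split; first exact/measurable_EFinP.
by move: foo; rewrite -ae_ge0_integral_norm.
Qed.

Lemma ae_le_integrable f g : measurable_fun setT f ->
  {ae mu, forall w, `|f w| <= g w} ->
  mu.-integrable setT (EFin \o g) -> mu.-integrable setT (EFin \o f).
Proof.
move=> mf fg /integrableP[mg goo]; apply/integrableP; split.
  exact/measurable_EFinP.
apply: le_lt_trans goo; apply: ae_ge0_le_integral => //.
- by apply: measurableT_comp => //; exact/measurable_EFinP.
- exact: measurableT_comp.
- by apply: filterS fg => w fg _ /=; rewrite lee_fin (le_trans fg) // ler_norm.
Qed.

Lemma ae_Rintegral_ge0 f : measurable_fun setT f ->
  {ae mu, forall w, 0 <= f w} -> 0 <= \int[mu]_w f w.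
Proof.
move=> mf f0; rewrite /Rintegral -ae_ge0_integral_norm //.
by apply: fine_ge0; apply: integral_ge0 => w _; rewrite lee_fin.
Qed.

Lemma ae_le_Rintegral f g : mu.-integrable setT (EFin \o f) ->
  mu.-integrable setT (EFin \o g) ->
  {ae mu, forall w, f w <= g w} -> \int[mu]_w f w <= \int[mu]_w g w.
Proof.
move=> intf intg fg; rewrite -subr_ge0 -RintegralB //.
apply: ae_Rintegral_ge0.
  by apply: measurable_funB; apply/measurable_EFinP;
    [exact: measurable_int intg|exact: measurable_int intf].
by apply: filterS fg => w; rewrite subr_ge0.
Qed.

Lemma ae_Rintegral_gt0 f : (0 < mu setT)%E -> mu.-integrable setT (EFin \o f) ->
  {ae mu, forall w, 0 < f w} -> 0 < \int[mu]_w f w.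
Proof.
move=> mu0 intf f0.
have mf : measurable_fun setT f.
  by apply/measurable_EFinP; exact: measurable_int intf.
have f0' : {ae mu, forall w, 0 <= f w} by apply: filterS f0 => w /ltW.
rewrite lt_neqAle ae_Rintegral_ge0 // andbT; apply/negP => /eqP I0.
have : (\int[mu]_w `|(EFin \o f) w| = 0)%E.
  rewrite (_ : (fun w => _) = (fun w => `|f w|%:E)) //.
  rewrite ae_ge0_integral_norm // -[LHS]fineK; last exact: integrable_fin_num.
  by rewrite -[fine _]I0.
move/ae_eq_integral_abs => /(_ measurableT) /= H.
have {}H : f = cst 0 %[ae mu].
  have /H : measurable_fun setT (EFin \o f) by exact/measurable_EFinP.
  by apply: filterS => w fw /fw [].
have: {ae mu, forall w : T, False}.
  by apply: filterS2 f0 H => w fw /(_ I) fE; move: fw; rewrite fE ltxx.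
(* Positive total mass makes the almost-everywhere filter proper, so [False] cannot hold almost
   everywhere. *)
have PF := ae_properfilter_algebraOfSetsType mu0.
by move/filter_ex => [].
Qed.

End ae_integral.

(** * The optimal price and the pointwise minimization *)

(* With [G c := N c - c * D c], optimality says [G c] is the minimum over [c']
   of [N c' - c * D c'], and the infimum of the ratios [N c / D c] is a zero
   of [G]. *)
Lemma ratio_min_fixpoint {R : realType} (N D : R -> R) (c0 : R) :
  (forall c, 0 < D c) ->
  (forall c c', N c - c * D c <= N c' - c * D c') ->
  0 <= N c0 - c0 * D c0 ->
  exists c, N c = c * D c.
Proof.
move=> D0 opt G0.
pose S := [set N c / D c | c in [set: R]].
have lbS c : 0 <= N c - c * D c -> lbound S c.
  by move=> Gc _ [c' _ <-]; rewrite ler_pdivlMr // -subr_ge0 (le_trans Gc).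
have hS : has_inf S by split; [exists (N 0 / D 0), 0|exists c0; exact: lbS].
exists (inf S); apply/eqP; rewrite -subr_eq0 eq_le; apply/andP; split; last first.
  rewrite subr_ge0 -ler_pdivlMr //; apply: ge_inf; first by case: hS.
  by exists (inf S).
rewrite leNgt; apply/negP => G_gt0.
set g := N _ - _ in G_gt0.
(* Adding the optimality inequalities at two prices shows that [D] is nondecreasing, so [M] bounds
   it just above [inf S]. *)
have DM (dl : R) : 0 < dl -> dl <= 1 -> D (inf S + dl) <= D (inf S + 1).
  move=> dl0; rewrite le_eqVlt => /orP[/eqP->//|dl1].
  have := opt (inf S + dl) (inf S + 1); have := opt (inf S + 1) (inf S + dl).
  nra.
set M := D (inf S + 1) in DM.
have M0 : 0 < M by exact: D0.
(* Raising the price by [dl] lowers the minimal difference by at most [dl * M <= g], so [inf S + dl]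
   would still be a lower bound of [S]. *)
pose dl := Num.min 1 (g / M).
have dl0 : 0 < dl by rewrite lt_min ltr01 divr_gt0.
have dl1 : dl <= 1 by rewrite ge_min lexx.
have dlM : dl * M <= g by rewrite -ler_pdivlMr // ge_min lexx orbT.
have : inf S + dl <= inf S.
  apply: lb_le_inf; first by case: hS.
  apply: lbS; have := opt (inf S) (inf S + dl); rewrite -/g.
  have := DM _ dl0 dl1; nra.
lra.
Qed.

(** Up to a constant the objective is [h] times [b * (y - a) ^+ 2 - (lambda - v / 2) * (y - a)], a
    parabola minimized over [y >= a] at its vertex, cut off at [a]. *)
Lemma priced_cost_min {R : realType} (a b e h lambda v y z c : R) :
  0 < b -> 0 < h -> 0 < v -> a <= y ->
  z = a + Num.max (Num.max lambda 0 - v / 2) 0 / (2 * b) ->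
  c = e + h * (lambda + 2 * a * b) ->
  (e - c) * z + h * (v * z / 2 + b * z ^+ 2) <=
  (e - c) * y + h * (v * y / 2 + b * y ^+ 2).
Proof.
move=> b0 h0 v0 ay zE cE.
have min_z : b * (z - a) ^+ 2 - (lambda - v / 2) * (z - a) <=
          b * (y - a) ^+ 2 - (lambda - v / 2) * (y - a).
  rewrite zE addrAC subrr add0r.
  have [m0|m0] := leP (Num.max lambda 0 - v / 2) 0.
    (* Here [z = a], and [lambda <= v / 2] makes both terms on the right nonnegative. *)
    rewrite mul0r expr0n /= !mulr0 subr0.
    have lv : lambda - v / 2 <= 0.
      by apply: le_trans m0; rewrite lerD2r le_max lexx.
    have := sqr_ge0 (y - a); nra.
  (* As [v > 0], a positive [m0] rules out [lambda <= 0], so the inner maximum is [lambda]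
     itself. *)
  have l0 : 0 < lambda.
    by rewrite ltNge; apply/negP => l0; move: m0; rewrite (max_idPr l0); lra.
  rewrite (max_idPl (ltW l0)); set m := lambda - v / 2.
  rewrite -subr_ge0.
  have -> : b * (y - a) ^+ 2 - m * (y - a) -
            (b * (m / (2 * b)) ^+ 2 - m * (m / (2 * b))) =
            b * (y - a - m / (2 * b)) ^+ 2.
    by field; rewrite gt_eqF.
  by rewrite mulr_ge0 ?sqr_ge0 // ltW.
rewrite cE -subr_ge0; move: min_z; rewrite -subr_ge0 => min_z.
have := mulr_ge0 (ltW h0) min_z; congr (0 <= _); ring.
Qed.

(** * Random rates and the minimal ratio *)

Section optimal_rate.
Context {disp : measure_display} {T : measurableType disp} {R : realType}.
Variables (P : probability T R) (V : T -> R) (rho mu r : R).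
Hypotheses (mV : measurable_fun setT V) (V0 : {ae P, forall w, 0 < V w}).
Hypothesis V2oo : ('E_P[fun w => (V w ^+ 2)%R] < +oo)%E.
Hypotheses (mu0 : 0 < mu) (rho0 : 0 < rho) (rhor : rho < r).

(** The cost depends on [X] only through the means of this integrand and the next; in
    [(X w - rho)^-1] they are linear and quadratic. *)
Let on_time (X : T -> R) w := V w / (X w - rho).
Let on_work (X : T -> R) w :=
  V w ^+ 2 / (2 * (X w - rho)) + mu * rho * (V w / (X w - rho) ^+ 2).
(** The truncation lets [lambda] run over all reals, so that every price is attained, while [phi]
    only receives a nonnegative parameter. *)
Let rate lambda := phi rho mu r (Num.max lambda 0) \o V.
Let a := (r - rho)^-1.
Let b := mu * rho.

Let a_gt0 : 0 < a. Proof. by rewrite invr_gt0 subr_gt0. Qed.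

Let b_gt0 : 0 < b. Proof. by rewrite mulr_gt0. Qed.

Let on_workE X w :
  on_work X w = V w * (V w * (X w - rho)^-1 / 2 + b * (X w - rho)^-1 ^+ 2).
Proof. by rewrite /on_work -exprVn invfM -/b; set y := _^-1; ring. Qed.

Let mon_time X : measurable_fun setT X -> measurable_fun setT (on_time X).
Proof.
move=> mX; apply: measurable_funM => //; apply: measurable_funV.
exact: measurable_funB.
Qed.

Let mon_work X : measurable_fun setT X -> measurable_fun setT (on_work X).
Proof.
move=> mX; have mXr : measurable_fun setT (fun w => X w - rho).
  exact: measurable_funB.
apply: measurable_funD.
  apply: measurable_funM; first exact: measurable_funX.
  by apply: measurable_funV; exact: measurable_funM.
apply: measurable_funM => //; apply: measurable_funM => //.
by apply: measurable_funV; exact: measurable_funX.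
Qed.

Let admissible_inv X : admissible P V rho r X ->
  {ae P, forall w, 0 < V w /\ a <= (X w - rho)^-1}.
Proof.
move=> [_ rX _]; apply: filterS2 V0 rX => w v0 [X1 X2]; split => //.
by rewrite lef_pV2 ?posrE ?subr_gt0 // lerD2r.
Qed.

Let on_time_gt0 X : admissible P V rho r X ->
  {ae P, forall w, 0 < on_time X w}.
Proof.
move/admissible_inv; apply: filterS => w [v0 /(lt_le_trans a_gt0) y0].
exact: mulr_gt0.
Qed.

Let on_work_ge0 X : admissible P V rho r X ->
  {ae P, forall w, 0 <= on_work X w}.
Proof.
move/admissible_inv; apply: filterS => w [v0 /(lt_le_trans a_gt0) y0].
rewrite on_workE; apply: mulr_ge0; first exact: ltW.
apply: addr_ge0; first by rewrite divr_ge0 // mulr_ge0 // ltW.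
by rewrite mulr_ge0 ?sqr_ge0 // ltW.
Qed.

Let on_time_int X : admissible P V rho r X ->
  P.-integrable setT (EFin \o on_time X).
Proof.
move=> aX; have [mX _ Xoo] := aX; apply: ae_ge0_integrable.
- exact: mon_time.
- by apply: filterS (on_time_gt0 aX) => w /ltW.
- by move: Xoo; rewrite unlock.
Qed.

Let on_work_int X : admissible P V rho r X ->
  ('E_P[on_work X] < +oo)%E ->
  P.-integrable setT (EFin \o on_work X).
Proof.
move=> aX Xoo; have [mX _ _] := aX; apply: ae_ge0_integrable.
- exact: mon_work.
- exact: on_work_ge0.
- by move: Xoo; rewrite unlock.
Qed.

(** A common dominating function: [V] and [V ^+ 2] are at most [1 + V ^+ 2], and [C] absorbs bounds
    on the reciprocal net rate. *)
Let V2_int C : P.-integrable setT (EFin \o (fun w => C * (1 + V w ^+ 2))).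
Proof.
rewrite (_ : _ \o _ = fun w => (C%:E * (1 + V w ^+ 2)%:E)%E); last first.
  by apply/funext => w; rewrite /= EFinM.
apply: integrableZl => //.
rewrite (_ : (fun w => _) = ((EFin \o cst 1%R) \+ (EFin \o (fun w => V w ^+ 2)%R))%E); last first.
  by apply/funext => w; rewrite /= EFinD.
apply: integrableD => //; first exact: finite_measure_integrable_cst.
apply: ae_ge0_integrable.
- exact: measurable_funX.
- by apply: aeW => w; exact: sqr_ge0.
- by move: V2oo; rewrite unlock.
Qed.

Let z lambda w :=
  a + Num.max (Num.max lambda 0 - V w / 2) 0 / (2 * b).

Let rateE lambda w : (rate lambda w - rho)^-1 = z lambda w.
Proof. by rewrite /rate /phi /= addrAC subrr add0r invrK /z /b mulrA. Qed.

Let z_ge lambda w : a <= z lambda w.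
Proof.
by rewrite lerDl divr_ge0 ?le_max ?lexx ?orbT // mulr_ge0 // ltW.
Qed.

Let z_le lambda w : 0 < V w -> z lambda w <= a + Num.max lambda 0 / (2 * b).
Proof.
move=> v0; rewrite lerD2l ler_pM2r ?invr_gt0 ?mulr_gt0 // ge_max.
apply/andP; split; last by rewrite le_max lexx orbT.
by rewrite gerBl divr_ge0 // ltW.
Qed.

Let mrate lambda : measurable_fun setT (rate lambda).
Proof.
apply: measurable_funD => //; apply: measurable_funV.
apply: measurable_funD => //; apply: measurable_funM => //.
apply: measurable_maxr => //; apply: measurable_funB => //.
exact: measurable_funM.
Qed.

Let rate_admissible lambda : admissible P V rho r (rate lambda).
Proof.
split => //.
  apply: aeW => w; have z0 := lt_le_trans a_gt0 (z_ge lambda w).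
  have -> : rate lambda w = rho + (z lambda w)^-1.
    by rewrite -rateE invrK addrC subrK.
  rewrite ltrDl invr_gt0 z0; split => //.
  rewrite -lerBrDl -[leRHS]invrK lef_pV2 ?posrE //; exact: z_ge.
rewrite unlock; apply: (@integrable_lty _ _ _ _ setT _ (EFin \o on_time (rate lambda))) => //.
set k := a + Num.max lambda 0 / (2 * b).
apply: ae_le_integrable (V2_int k); first exact: mon_time.
apply: filterS V0 => w v0; rewrite /on_time rateE.
have z0 := lt_le_trans a_gt0 (z_ge lambda w); have zk := z_le lambda v0.
rewrite ger0_norm; last by rewrite mulr_ge0 // ltW.
(* For [V w > 0] this square gives [V w <= 1 + V w ^+ 2]. *)
rewrite -/k in zk; have := sqr_ge0 (V w - 1).
move: (V w) (z lambda w) v0 z0 zk => v y v0 y0 yk; nra.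
Qed.

Let on_work_rate_int lambda :
  P.-integrable setT (EFin \o on_work (rate lambda)).
Proof.
set k := a + Num.max lambda 0 / (2 * b).
(* The constant bounds [y / 2 + b * y ^+ 2] for [0 <= y <= k]. *)
apply: ae_le_integrable (V2_int (k / 2 + b * k ^+ 2)); first exact: mon_work.
apply: filterS V0 => w v0; rewrite on_workE rateE.
have z0 := lt_le_trans a_gt0 (z_ge lambda w); have zk := z_le lambda v0.
rewrite -/k in zk; move: (V w) (z lambda w) v0 z0 zk => v y v0 y0 yk.
have b0 := b_gt0.
have y2k2 : y ^+ 2 <= k ^+ 2 by rewrite ler_pXn2r ?nnegrE // ltW // (lt_le_trans y0).
have y20 : 0 <= y ^+ 2 := sqr_ge0 y.
rewrite ger0_norm; last first.
  by rewrite mulr_ge0 ?(ltW v0) // addr_ge0 ?divr_ge0 ?mulr_ge0 // ltW.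
have vv : v <= 1 + v ^+ 2 by have := sqr_ge0 (v - 1); nra.
have h1 : v ^+ 2 * y <= (1 + v ^+ 2) * k.
  apply: ler_pM => //; [exact: sqr_ge0|exact: ltW|lra].
have h2 : v * y ^+ 2 <= (1 + v ^+ 2) * k ^+ 2 by apply: ler_pM => //; exact: ltW.
have := ler_wpM2l (ltW b0) h2; lra.
Qed.

Let on_time_Rint_gt0 X : admissible P V rho r X -> 0 < \int[P]_w on_time X w.
Proof.
move=> aX; apply: ae_Rintegral_gt0 (on_time_int aX) (on_time_gt0 aX).
have := @probability_setT _ _ _ P => PT; rewrite [X in (_ < X)%E]PT; exact: lte01.
Qed.

Variables (e h : R).
Hypothesis h0 : 0 < h.
Let price lambda := e + h * (lambda + 2 * a * b).

(** The pointwise inequality is multiplied by [V] and integrated; integrability of [on_work X] lets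
    the expectations split. *)
Let rate_opt lambda X : admissible P V rho r X ->
  P.-integrable setT (EFin \o on_work X) ->
  (e - price lambda) * \int[P]_w on_time (rate lambda) w +
    h * \int[P]_w on_work (rate lambda) w <=
  (e - price lambda) * \int[P]_w on_time X w + h * \int[P]_w on_work X w.
Proof.
move=> aX X2.
have intZ k f : P.-integrable setT (EFin \o f) ->
    P.-integrable setT (EFin \o (fun w => k * f w)).
  by move=> fi; apply: (@integrableZl _ _ _ _ _ measurableT k (EFin \o f)).
have intD f g : P.-integrable setT (EFin \o f) -> P.-integrable setT (EFin \o g) ->
    P.-integrable setT (EFin \o (fun w => f w + g w)).
  by move=> fi gi; apply: (@integrableD _ _ _ _ _ measurableT (EFin \o f) (EFin \o g)).
have Xt := on_time_int aX.
have lt := on_time_int (rate_admissible lambda).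
have lw := on_work_rate_int lambda.
rewrite -!RintegralZl // -!RintegralD //; do ?[exact: intZ].
apply: ae_le_Rintegral; do ?[by apply: intD; exact: intZ].
apply: filterS (admissible_inv aX) => w [v0 ay].
have := @priced_cost_min _ a b e h lambda _ _ _ _ b_gt0 h0 v0 ay erefl erefl.
move=> /(ler_wpM2l (ltW v0)) /=.
rewrite !on_workE /on_time rateE -/(price lambda) -/(z lambda w).
by congr (_ <= _); ring.
Qed.

(** [t] stands for the mean of [tau] and [A] for the part of the numerator free of [X]; [A] is
    extended because the off-period workload is not assumed to have finite mean. *)
Lemma optimal_rate (t : R) (A : \bar R) : 0 <= t ->
  exists lambda : R, [/\ 0 <= lambda,
    admissible P V rho r (phi rho mu r lambda \o V) &
    forall X, admissible P V rho r X ->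
      let C X := ((A + e%:E * 'E_P[on_time X] + h%:E * 'E_P[on_work X]) /
        (t%:E + 'E_P[on_time X]))%E in
      (C (phi rho mu r lambda \o V) <= C X)%E].
Proof.
move=> t0.
have ET X : admissible P V rho r X ->
    ('E_P[on_time X] = (\int[P]_w on_time X w)%:E)%E.
  by move=> aX; rewrite unlock /Rintegral fineK // integrable_fin_num // on_time_int.
have den X : admissible P V rho r X -> 0 < t + \int[P]_w on_time X w.
  by move=> aX; rewrite ltr_wpDl // on_time_Rint_gt0.
have divE X N : admissible P V rho r X ->
    (N / (t%:E + 'E_P[on_time X]) =
     N * ((t + \int[P]_w on_time X w)^-1)%:E)%E.
  by move=> aX; rewrite ET // -EFinD inver gt_eqF ?den.
have W0 X : admissible P V rho r X -> ('E_P[on_work X] != -oo)%E.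
  move=> aX; have [mX _ _] := aX.
  rewrite gt_eqF // unlock -ae_ge0_integral_norm; first last.
  - exact: on_work_ge0.
  - exact: mon_work.
  by apply: (@lt_le_trans _ _ 0%E) => //; apply: integral_ge0 => w _; rewrite lee_fin.
case: A => [A||].
- pose N l := A + e * \int[P]_w on_time (rate l) w + h * \int[P]_w on_work (rate l) w.
  pose D l := t + \int[P]_w on_time (rate l) w.
  pose lam c := (c - e) / h - 2 * a * b.
  have lamK c : price (lam c) = c.
    by rewrite /price /lam; field; rewrite gt_eqF.
  pose c1 := price 0.
  (* Up to the price [c1] the rate stays equal to [rate 0], so [N] and [D] are frozen there; capping
     by [N 0 / D 0] makes the difference at [c0] nonnegative. *)
  pose c0 := Num.min c1 (N 0 / D 0).
  have D0 l : 0 < D l by exact/den/rate_admissible.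
  have c0E : rate (lam c0) = rate 0.
    rewrite /rate (max_idPr _) ?(max_idPr (lexx 0)) //.
    rewrite /lam subr_le0 ler_pdivrMr //.
    have : c0 <= c1 by rewrite /c0 ge_min lexx.
    by rewrite /c1 /price; lra.
  have [|||c Gc] := @ratio_min_fixpoint _ (N \o lam) (D \o lam) c0.
  + by move=> c; exact: D0.
  + move=> c c'; have := rate_opt (lam c) (rate_admissible (lam c'))
      (on_work_rate_int _).
    by rewrite /N /D /= lamK; lra.
  + rewrite /= /N /D c0E -/(N 0) -/(D 0) subr_ge0 -ler_pdivlMr //.
    by rewrite /c0 ge_min lexx orbT.
  rewrite /= in Gc.
  exists (Num.max (lam c) 0); split; first by rewrite le_max lexx orbT.
    exact: rate_admissible.
  move=> X aX /=; rewrite -/(rate (lam c)).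
  have aR := rate_admissible (lam c).
  (* An infinite mean of [on_work X] makes the cost of [X] infinite, so only integrable competitors
     remain. *)
  have [Xoo|Xoo] := eqVneq ('E_P[on_work X])%E +oo%E.
    rewrite [leRHS]divE // Xoo gt0_muley ?lte_fin // (ET _ aX) -EFinM -EFinD.
    by rewrite addey // gt0_mulye ?leey // lte_fin invr_gt0 den.
  have Xi : P.-integrable setT (EFin \o on_work X).
    by apply: on_work_int => //; rewrite lt_neqAle Xoo leey.
  have EW Y : P.-integrable setT (EFin \o on_work Y) ->
      ('E_P[on_work Y] = (\int[P]_w on_work Y w)%:E)%E.
    by move=> Yi; rewrite unlock /Rintegral fineK // integrable_fin_num.
  rewrite !divE // (ET _ aX) (ET _ aR) (EW _ Xi) (EW _ (on_work_rate_int _)).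
  rewrite -!EFinM lee_fin.
  (* By [Gc] the candidate's ratio is [c], and the minimal difference at price [c] is 0; [rate_opt]
     then bounds the ratio of [X] below by [c]. *)
  rewrite -/(N (lam c)) -/(D (lam c)) Gc mulfK ?gt_eqF // ler_pdivlMr ?den //.
  have := rate_opt (lam c) aX Xi; move: Gc; rewrite /N /D lamK; lra.
(* With [A = +oo] the cost of [X] is [+oo]; [W0] excludes a summand [-oo], which would absorb
   [+oo]. *)
- exists 0; have aR := rate_admissible 0.
  rewrite /rate (max_idPr (lexx 0)) in aR.
  split => // X aX /=.
  rewrite [leRHS]divE // (ET _ aX) -EFinM [Y in (_ <= Y * _)%E]addye; last first.
    have := W0 _ aX; case: ('E_P[on_work X])%E => [s||] // _.
    by rewrite gt0_muley ?lte_fin.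
  by rewrite gt0_mulye ?leey // lte_fin invr_gt0 den.
(* With [A = -oo] the candidate costs [-oo], since [-oo] absorbs every summand. *)
- exists 0; have aR := rate_admissible 0.
  rewrite /rate (max_idPr (lexx 0)) in aR.
  split => // X aX /=.
  rewrite [leLHS]divE // !addNye gt0_mulNye ?leNye // lte_fin invr_gt0 den //.
Qed.

End optimal_rate.

(** * Monotonicity of the rate and conclusion *)

(** The positive part is nonincreasing in [v], and the reciprocal reverses the order. *)
Lemma phi_nondecreasing {R : realType} (rho mu r lambda : R) :
  0 < mu -> 0 < rho -> rho < r -> {homo phi rho mu r lambda : v w / v <= w}.
Proof.
move=> mu0 rho0 rhor v w vw; rewrite /phi lerD2l.
have pos x : 0 < (r - rho)^-1 + Num.max (lambda - x / 2) 0 / (2 * mu * rho).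
  rewrite ltr_pwDl ?invr_gt0 ?subr_gt0 // divr_ge0 ?le_max ?lexx ?orbT //.
  by rewrite !mulr_ge0 // ltW.
rewrite lef_pV2 ?posrE // lerD2l ler_pM2r; last by rewrite invr_gt0 !mulr_gt0.
rewrite ge_max !le_max lexx !orbT andbT; apply/orP; left; lra.
Qed.

Theorem mainTheorem5 (R : realType) (disp : measure_display)
    (T : measurableType disp) (P : probability T R) (F : R -> set (set T))
    (J : R -> T -> R) (nu : {measure set (measurableTypeR R) -> \bar R})
    (tau : T -> \bar R) (rho mu r h K d : R)
    (hF : filtration F) (hFu : usual_conditions P F)
    (hJ : subordinator P F J) (hnu : levy_measure_of P J nu)
    (hrho : ('E_P[J 1%R] = rho%:E)%E)
    (htau : stopping_time F tau) (hEtau : (\int[P]_w tau w < +oo)%E)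
    (hV : {ae P, forall w, 0 < stopped J tau w})
    (hEV2 : ('E_P[fun w => (stopped J tau w ^+ 2)%R] < +oo)%E)
    (hmu : (mu%:E = ((2 * rho)^-1)%:E * \int[nu]_(x in `]0%R, +oo[) (x ^+ 2)%:E)%E)
    (hmu0 : 0 < mu) (hh : 0 < h) (hK : 0 < K) (hd : 0 < d) (hr : rho < r) :
  exists lambda : R,
    [/\ 0 <= lambda,
        {in `[0, +oo[ &, {homo phi rho mu r lambda : v w / v <= w}},
        admissible P (stopped J tau) rho r
          (phi rho mu r lambda \o stopped J tau) &
        forall X : T -> R, admissible P (stopped J tau) rho r X ->
          (cost P J tau rho mu h K d (phi rho mu r lambda \o stopped J tau)
           <= cost P J tau rho mu h K d X)%E].
Proof.
have [cP _ _] := hFu.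
have [aJ paths _ _] := hJ.
(* If [rho <= 0], then [(2 * rho)^-1 <= 0] (the inverse of 0 being 0), and [hmu] would make [mu]
   nonpositive. *)
have rho0 : 0 < rho.
  have I0 : (0 <= \int[nu]_(x in `]0%R, +oo[) (x ^+ 2)%:E)%E.
    by apply: integral_ge0 => x _; rewrite lee_fin sqr_ge0.
  rewrite ltNge; apply/negP => rho_le0; move: hmu0; rewrite -lte_fin hmu ltNge.
  by move/negP; apply; rewrite mule_le0_ge0 // lee_fin invr_le0 mulr_ge0_le0.
have mV : measurable_fun setT (stopped J tau).
  apply: (stopped_measurable_fun hF cP aJ) htau.
  by apply: filterS paths => w [].
have [tau0 _] := htau.
have Etau0 : (0 <= \int[P]_w tau w)%E by apply: integral_ge0.
have Etau_fin : (\int[P]_w tau w)%E \is a fin_num by rewrite ge0_fin_numE.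
have t0 : 0 <= fine (\int[P]_w tau w)%E by exact: fine_ge0.
pose A := (h%:E * \int[P]_w tau w * mean_off_workload P J tau + K%:E +
           d%:E * 'E_P[stopped J tau])%E.
(* The coefficient [e] of the mean on time in the numerator is [d * rho]. *)
have [lambda [l0 adm opt]] :=
  optimal_rate mV hV hEV2 hmu0 rho0 hr (d * rho) hh A t0.
exists lambda; split => //.
  by move=> v w _ _; exact: phi_nondecreasing.
by move=> X aX; have := opt X aX; rewrite /= EFinM fineK.
Qed.
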